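(* Let $n\ge2$, let $G(V,E)$ be a directed graph on $V=\{1,\dots,n\}$ with $m=|E|$ edges and positive weights $\alpha_{ij}$ ($ij\in E$), let $r_i>0$, $\tau>0$, $g^w_{ij}>0$ ($ij\in E$), and assume that $G$ is connected, $\kappa_1\neq\kappa_2$, $0<p<2$ and $\rho(\hat J_2)<1$. Consider the mean dynamics of the noisy clock synchronization system defined in the context, with stationary noise mean $\bar w=[\bar w_{ij}]_{ij\in E}\in\mathbb R^m$, and let $\tilde s(t_k)$ be the corresponding collective frequency. (a) If $G$ does not have a unique leader, then for all $\bar w\in\mathbb R^m$ outside a set of Lebesgue measure zero the collective frequency $\tilde s(t_k)$ constantly drifts, i.e. $\tilde s(t_{k+1})-\tilde s(t_k)$ converges to a nonzero constant as $k\to\infty$. (b) If $G$ has a unique leader, then for every $\bar w\in\mathbb R^m$ and every initial condition, $\tilde s(t_k)$ converges, as $k\to\infty$, to $$r^*=\gamma\sum_{i=1}^n\xi_i\Big(s_i(t_0)-\frac{\kappa_2}{p}y_i(t_0)\Big).$$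
   Context: $G(V,E)$ has no self-loops; $ij\in E$ means node $i$ measures its clock offset with respect to $j$, and $\mathcal N_i=\{j:ij\in E\}$. A leader is a node to whom every other node can reach through a directed path; $G$ is connected if it has at least one leader (equivalently, the Laplacian has $0$ as a simple eigenvalue), and $G$ has a unique leader if it has exactly one. The Laplacian $L\in\mathbb R^{n\times n}$ has $L_{ii}=\sum_{j\in\mathcal N_i}\alpha_{ij}$, $L_{ij}=-\alpha_{ij}$ if $ij\in E$, $0$ otherwise. $R=\mathrm{diag}(r_i)$. In the noisy system each offset measurement $x_j(t_k)-x_i(t_k)$ is replaced by $x_j(t_k)-x_i(t_k)+g^w_{ij}w_{ij}(t_k)$, where $w_{ij}(t_k)$ is random with stationary mean $E[w_{ij}(t_k)]=\bar w_{ij}$, and the skew update receives an additional zero-mean noise (clock wander). The mean dynamics, i.e. the evolution of the first moments $x_i(t_k),s_i(t_k),y_i(t_k)$ (same symbols used for the expectations, $t_k=t_0+k\tau$), is $$x_i(t_{k+1})=x_i(t_k)+\tau r_is_i(t_k),$$ $$s_i(t_{k+1})=s_i(t_k)+\kappa_1\sum_{j\in\mathcal N_i}\alpha_{ij}\big(x_j(t_k)-x_i(t_k)+g^w_{ij}\bar w_{ij}\big)-\kappa_2y_i(t_k),$$ $$y_i(t_{k+1})=p\sum_{j\in\mathcal N_i}\alpha_{ij}\big(x_j(t_k)-x_i(t_k)+g^w_{ij}\bar w_{ij}\big)+(1-p)y_i(t_k).$$ $\xi$ is the unique left eigenvector of $L$ for the eigenvalue $0$ with $\sum_i\xi_i=1$,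 $\frac1\gamma=\sum_i\frac{\xi_i}{r_i}$, and the collective frequency is $\tilde s(t_k)=\gamma\sum_i\xi_is_i(t_k)$. Let $$A=\begin{bmatrix} I_n&\tau R&0\\-\kappa_1L&I_n&-\kappa_2I_n\\-pL&0&(1-p)I_n\end{bmatrix}.$$ When $G$ is connected, $\kappa_1\ne\kappa_2$, $p>0$, the $3n$ eigenvalues of $A$ (with multiplicity) include $1,1,1-p$, the Jordan form of $A$ is $\mathrm{blockdiag}(\hat J_1,\hat J_2)$ with $\hat J_1=\begin{bmatrix}1&1&0\\0&1&0\\0&0&1-p\end{bmatrix}$, and $\hat J_2$ collects the Jordan blocks of the remaining $3n-3$ eigenvalues. $\rho$ denotes spectral radius. *)

(* Defs.v *)
From HB Require Import structures.
From mathcomp Require Import all_boot all_order all_algebra.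
From mathcomp Require Import mxred.
From mathcomp Require Import complex.
From mathcomp Require Import all_classical all_reals all_analysis.

Set Implicit Arguments.
Unset Strict Implicit.
Unset Printing Implicit Defensive.

Import Order.TTheory GRing.Theory Num.Theory.
Import numFieldNormedType.Exports.

Local Open Scope classical_set_scope.
Local Open Scope ring_scope.

Section Graph.
Variables (n : nat) (E : rel 'I_n).

(* [E i j] means that node i measures its offset to j; the leader is reached
   from the other nodes along these directed edges. *)
Definition is_leader (l : 'I_n) : Prop :=
  forall i : 'I_n, i != l -> connect E i l.

Definition connected_graph : Prop := exists l, is_leader l.

Definition has_unique_leader : Prop := exists! l, is_leader l.

Definition edge := {e : 'I_n * 'I_n | E e.1 e.2}.

End Graph.

Section Clock.
Variables (R : realType) (n : nat) (E : rel 'I_n).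
Variable alpha : 'I_n -> 'I_n -> R.

Definition laplacian : 'M[R]_n :=
  \matrix_(i, j) (if i == j then \sum_(k | E i k) alpha i k
                  else if E i j then - alpha i j else 0).

Definition sync_mx (r : 'I_n -> R) (tau kappa1 kappa2 p : R) :
    'M[R]_(n + (n + n)) :=
  block_mx 1%:M
           (row_mx (tau *: diag_mx (\row_i r i)) 0)
           (col_mx (- kappa1 *: laplacian) (- p *: laplacian))
           (block_mx 1%:M (- kappa2 *: 1%:M)
                     0    ((1 - p) *: 1%:M)).

(* The noise mean is a vector indexed by the edges, i.e. a point of R^m with
   m = #|edge E|; [edge_value w i j] is its ij entry (0 if ij is not an edge). *)
Definition edge_value (w : edge E -> R) (i j : 'I_n) : R :=
  if insub (i, j) is Some e then w e else 0.

Definition offset_sum (g : 'I_n -> 'I_n -> R) (w : edge E -> R)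
    (x : 'I_n -> R) (i : 'I_n) : R :=
  \sum_(j | E i j) alpha i j * (x j - x i + g i j * edge_value w i j).

(* [x k i] is the mean of x_i at time t_k = t_0 + k tau, likewise s and y. *)
Definition mean_dynamics (r : 'I_n -> R) (g : 'I_n -> 'I_n -> R)
    (tau kappa1 kappa2 p : R) (w : edge E -> R)
    (x s y : nat -> 'I_n -> R) : Prop :=
  forall (k : nat) (i : 'I_n),
    [/\ x k.+1 i = x k i + tau * r i * s k i,
        s k.+1 i = s k i + kappa1 * offset_sum g w (x k) i - kappa2 * y k i
      & y k.+1 i = p * offset_sum g w (x k) i + (1 - p) * y k i].

Definition gamma_of (xi : 'rV[R]_n) (r : 'I_n -> R) : R :=
  (\sum_i xi 0 i / r i)^-1.

Definition collective_freq (xi : 'rV[R]_n) (r : 'I_n -> R)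
    (s : 'I_n -> R) : R :=
  gamma_of xi r * \sum_i xi 0 i * s i.

End Clock.

Section Jordan.
Variable R : realType.

Definition jordan_block (F : fieldType) (k : nat) (a : F) : 'M[F]_k :=
  \matrix_(i, j) (if j == i then a else if j == i.+1 :> nat then 1 else 0).

Definition is_jordan_mx (F : fieldType) (N : nat) (J : 'M[F]_N) : Prop :=
  exists (q : nat) (d : 'I_q -> nat) (a : 'I_q -> F)
         (dN : (\sum_i d i)%N = N),
    (forall i, (0 < d i)%N) /\
    J = castmx (dN, dN) (\mxdiag_i jordan_block (d i) (a i)).

Definition spectral_radius (N : nat) (M : 'M[R[i]]_N) : R :=
  sup [set ComplexField.Normc.normc a | a in [set a : R[i] | eigenvalue M a]].

Definition complexify (m n : nat) (M : 'M[R]_(m, n)) : 'M[R[i]]_(m, n) :=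
  map_mx (real_complex R) M.

Definition J1_hat (p : R) : 'M[R[i]]_(2 + 1) :=
  block_mx (jordan_block 2 1) 0
           0 (jordan_block 1 (real_complex R (1 - p))).

(* The base change P is stated as a rectangular matrix because the sizes
   n + (n + n) and 3 + (3 * n - 3) are equal but not convertible (0 < n);
   being row free and row full makes it invertible. *)
Definition jordan_form_split (n : nat) (A : 'M[R]_(n + (n + n))) (p : R)
    (J2 : 'M[R[i]]_(3 * n - 3)) : Prop :=
  is_jordan_mx J2 /\
  exists P : 'M[R[i]]_((2 + 1) + (3 * n - 3), n + (n + n)),
    [/\ row_free P, row_full P
      & similar P (complexify A) (block_mx (J1_hat p) 0 0 J2)].

End Jordan.

(* Sets of Lebesgue (outer) measure zero in R^I, I finite: coverable by
   countably many closed boxes of arbitrarily small total volume. The library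
   has Lebesgue measure only on R. *)
Definition lebesgue_null (R : realType) (I : finType) (N : set (I -> R)) : Prop :=
  forall eps : R, 0 < eps ->
    exists a b : nat -> I -> R,
      [/\ forall k i, a k i <= b k i,
          N `<=` \bigcup_k [set w | forall i, a k i <= w i <= b k i]
        & (\sum_(0 <= k <oo) (\prod_i (b k i - a k i))%:E <= eps%:E)%E].

(* Main.v *)
(* Weighting the dynamics by [xi] cancels the Laplacian: with
   [S = sum_i xi_i s_i], [Y = sum_i xi_i y_i] and the noise term
   [c = sum_(ij) xi_i alpha_ij g_ij w_ij],
     [S' = S + kappa1 c - kappa2 Y]   and   [Y' = p c + (1 - p) Y].
   As [|1 - p| < 1], [Y] tends to [c], so that [S' - S] tends to
   [(kappa1 - kappa2) c], and if [c = 0] then [S - (kappa2 / p) Y] is invariant.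
   A positive entry of a nonnegative left null vector of the Laplacian
   propagates along the edges. Hence [xi >= 0], which gives [gamma <> 0], and
   [xi] is supported on the leader if it is unique; such a leader has no
   outgoing edge, so that [c = 0]. Without a unique leader every node has an
   outgoing edge, and [c] is a nonzero linear form in [w], which vanishes only
   on a hyperplane. *)
Require Import Defs.
From HB Require Import structures.
From mathcomp Require Import all_boot all_order all_algebra.
From mathcomp Require Import mxred.
From mathcomp Require Import complex.
From mathcomp Require Import all_classical all_reals all_analysis.
From mathcomp Require Import ring lra.

Set Implicit Arguments.
Unset Strict Implicit.
Unset Printing Implicit Defensive.

Import Order.TTheory GRing.Theory Num.Theory.
Import numFieldNormedType.Exports.

Local Open Scope classical_set_scope.
Local Open Scope ring_scope.

(** * Null sets in [I -> R]: countable unions and hyperplanes *)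

(** The [k]-th set is covered with volume [eps / 2 ^ (k + 1)], and a bijection [h] from [nat] to
    pairs lists all the boxes as one sequence. The volumes are nonnegative, so their sum can be
    rearranged. *)
Lemma lebesgue_null_bigcup {R : realType} {I : finType}
    (N : nat -> set (I -> R)) :
  (forall k, lebesgue_null (N k)) -> lebesgue_null (\bigcup_k N k).
Proof.
move=> N_null eps eps_gt0.
have cover k : exists ab : (nat -> I -> R) * (nat -> I -> R),
    [/\ forall l i, ab.1 l i <= ab.2 l i,
        N k `<=` \bigcup_l [set w | forall i, ab.1 l i <= w i <= ab.2 l i]
      & (\sum_(0 <= l <oo) (\prod_i (ab.2 l i - ab.1 l i))%:E
           <= (eps / (2 ^ k.+1)%:R)%:E)%E].
  have [|a [b [? ? ?]]] := N_null k (eps / (2 ^ k.+1)%:R); last by exists (a, b).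
  by rewrite divr_gt0 // ltr0n expn_gt0.
have {cover N_null} [ab abP] := choice cover.
have /card_esym/card_set_bijP[h hP] := card_nat2.
have vol_ge0 k l : (0 <= (\prod_i ((ab k).2 l i - (ab k).1 l i))%:E)%E.
  have [le_ab _ _] := abP k.
  by rewrite lee_fin prodr_ge0// => i _; rewrite subr_ge0.
exists (fun m => (ab (h m).1).1 (h m).2), (fun m => (ab (h m).1).2 (h m).2).
split.
- by move=> m i; have [le_ab _ _] := abP (h m).1.
- move=> w [k _ Nkw].
  have [_ /(_ w Nkw)[l _ wl] _] := abP k.
  have [_ _ /(_ (k, l) Logic.I)[m _ hm]] := hP.
  by exists m => //=; rewrite hm.
- rewrite nneseries_esum//.
  have -> : [set x : nat | xpredT x] = setT by apply/seteqP; split.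
  rewrite -(reindex_esum _ _ _ (fun kl : nat * nat =>
    (\prod_i ((ab kl.1).2 kl.2 i - (ab kl.1).1 kl.2 i))%:E) hP).
  have -> : [set: nat * nat] = [set: nat] `*`` (fun=> setT).
    by apply/seteqP; split => -[].
  rewrite -(@esum_esum _ _ _ setT (fun=> setT)
    (fun k l => (\prod_i ((ab k).2 l i - (ab k).1 l i))%:E))//.
  apply: le_trans (epsilon_trick0 xpredT (ltW eps_gt0)).
  rewrite nneseries_esum; last first.
    by move=> k _; rewrite lee_fin divr_ge0// ltW.
  have -> : [set x : nat | xpredT x] = setT by apply/seteqP; split.
  apply: le_esum => k _; have [_ _] := abP k.
  rewrite nneseries_esum//.
  by have -> : [set x : nat | xpredT x] = setT by apply/seteqP; split.
Qed.

(* The point [i0] makes the constant box [0] a box of zero volume, with which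
   the finite cover is padded to a sequence. *)
Lemma lebesgue_null_finite_cover {R : realType} {I : finType} (i0 : I)
    (N : set (I -> R)) :
  (forall eps, 0 < eps -> exists (F : finType) (a b : F -> I -> R),
    [/\ forall f i, a f i <= b f i,
        forall w, N w -> exists f, forall i, a f i <= w i <= b f i
      & \sum_f \prod_i (b f i - a f i) <= eps]) ->
  lebesgue_null N.
Proof.
move=> cover eps /cover[F [a [b [le_ab Nab vol_le]]]].
pose pad (c : F -> I -> R) k i :=
  if insub k is Some j then c (@enum_val F predT j) i else 0.
have le_pad k i : pad a k i <= pad b k i by rewrite /pad; case: insubP.
have padE c f i : pad c (enum_rank f) i = c f i.
  by rewrite /pad valK enum_rankK.
exists (pad a), (pad b); split => //.
- move=> w /Nab[f wf]; exists (enum_rank f) => //= i.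
  by rewrite !padE.
- rewrite (nneseries_split 0%N #|F|); last first.
    by move=> k _; rewrite lee_fin prodr_ge0// => i _; rewrite subr_ge0.
  rewrite eseries0 ?adde0 ?add0n; last first.
    move=> k kF _; rewrite (bigD1 i0)//= /pad.
    by rewrite insubF ?subrr ?mul0r// ltnNge kF.
  rewrite sumEFin lee_fin big_mkord; apply: le_trans vol_le.
  rewrite (reindex enum_rank)/=; last exact/onW_bij/enum_rank_bij.
  by apply: ler_sum => f _; under eq_bigr do rewrite !padE.
Qed.

(** Over a cell of side [h] in the coordinates other than [i0], the linear function stays within
    [C * h] of its value at the corner, so one box of height [2 * C * h] per cell suffices. *)
Lemma lebesgue_null_bounded_graph {R : realType} {I : finType} (i0 : I)
    (c : I -> R) (K : nat) :
  lebesgue_null [set w : I -> R |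
    (forall i, `|w i| <= K%:R) /\ w i0 = \sum_(i | i != i0) c i * w i].
Proof.
apply: (lebesgue_null_finite_cover i0) => eps eps_gt0.
pose C := \sum_(i | i != i0) `|c i|.
have C_ge0 : 0 <= C by exact: sumr_ge0.
(* [B * h] bounds the total volume: each coordinate other than [i0] contributes
   [(2 * K * M + 1) * h <= 2 * K + 1]. The choice of [M] makes [B * h] at most [eps]. *)
pose B := 2 * C * \prod_(i : I | i != i0) (2 * K%:R + 1).
have B_ge0 : 0 <= B by rewrite mulr_ge0 ?mulr_ge0 ?prodr_ge0.
pose M := (Num.truncn (B / eps)).+1.
pose h : R := M%:R^-1.
have M_gt0 : 0 < M%:R :> R by rewrite ltr0n.
have h_gt0 : 0 < h by rewrite invr_gt0.
have h_le1 : h <= 1 by rewrite invf_le1// ler1n.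
pose F : finType := {ffun I -> 'I_(2 * K * M).+1}.
pose corner (f : F) i : R := - K%:R + (f i : nat)%:R * h.
pose v (f : F) := \sum_(i | i != i0) c i * corner f i.
(* Only the boxes with [f i0 = 0] are used; the others are made flat, so that
   the total volume is the expansion of a product of sums. *)
pose d (f : F) := if f i0 == ord0 then C * h else 0.
have d_ge0 f : 0 <= d f by rewrite /d; case: ifP => // _; rewrite mulr_ge0// ltW.
exists F, (fun f i => if i == i0 then v f - d f else corner f i),
  (fun f i => if i == i0 then v f + d f else corner f i + h).
split.
- by move=> f i; case: ifP => _; have := d_ge0 f; lra.
- move=> w [w_le wi0].
  have wK i : 0 <= (w i + K%:R) * M%:R.
    by rewrite mulr_ge0 ?(ltW M_gt0)//; move: (w_le i); rewrite ler_norml; lra.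
  pose f : F := [ffun i => if i == i0 then ord0
                           else inord (Num.truncn ((w i + K%:R) * M%:R))].
  have f_corner i : i != i0 -> corner f i <= w i <= corner f i + h.
    (* A coordinate equal to [K] has index exactly [2 * K * M]; hence the successor in the index
       type. *)
    move=> /negbTE ii0; rewrite /corner ffunE ii0 inordK; last first.
      rewrite truncn_lt_nat//; apply: (@le_lt_trans _ _ (2 * K * M)%:R).
        rewrite !natrM ler_wpM2r ?(ltW M_gt0)//.
        by move: (w_le i); rewrite ler_norml; lra.
      by rewrite ltr_nat.
    have /andP[lo hi] := truncn_itv (wK i).
    have lo' : (Num.truncn ((w i + K%:R) * M%:R))%:R * h <= w i + K%:R.
      by rewrite ler_pdivrMr.
    have hi' : w i + K%:R <= (Num.truncn ((w i + K%:R) * M%:R))%:R * h + h.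
      by rewrite -{2}[h]mul1r -mulrDl natr1 ler_pdivlMr// ltW.
    lra.
  exists f => i; case: ifP => [/eqP->|/negbT]; last exact: f_corner.
  rewrite /d ffunE eqxx eqxx wi0.
  suff : `|\sum_(i | i != i0) c i * w i - v f| <= C * h.
    by rewrite ler_norml; lra.
  rewrite -sumrB (le_trans (ler_norm_sum _ _ _))// mulr_suml.
  apply: ler_sum => j /f_corner wj.
  by rewrite -mulrBr normrM ler_wpM2l// ler_norml; lra.
(* The side of box [f] in direction [i] depends on [f i] only, so the sum over [f] factors into a
   product over [i]. *)
- pose G i (j : 'I_(2 * K * M).+1) : R :=
    if i == i0 then if j == ord0 then 2 * C * h else 0 else h.
  under eq_bigr => f _.
    have -> : \prod_i ((if i == i0 then v f + d f else corner f i + h) -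
         (if i == i0 then v f - d f else corner f i)) = \prod_i G i (f i).
      apply: eq_bigr => i _; rewrite /G; case: eqP => [->|_]; last by ring.
      by rewrite /d; case: ifP => _; ring.
    over.
  rewrite -bigA_distr_bigA (bigD1 i0)//=.
  have -> : \sum_j G i0 j = 2 * C * h.
    by rewrite (bigD1 ord0)//= big1 /G ?eqxx ?addr0// => j /negbTE->.
  apply: (@le_trans _ _ (2 * C * h * \prod_(i : I | i != i0) (2 * K%:R + 1))).
    rewrite ler_wpM2l//; first by rewrite mulr_ge0 ?(ltW h_gt0)// mulr_ge0.
    apply: ler_prod => i /negbTE ii0.
    under eq_bigr do rewrite /G ii0.
    rewrite sumr_const card_ord -[h *+ _]mulr_natl; apply/andP; split.
      by rewrite mulr_ge0// ltW.
    rewrite -natr1 mulrDl mul1r !natrM -mulrA divff ?gt_eqF// mulr1.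
    by rewrite lerD2l.
  rewrite -mulrA (mulrC h) mulrA -/B ler_pdivrMr// mulrC -ler_pdivrMr//.
  by have /andP[_ /ltW] := truncn_itv (divr_ge0 B_ge0 (ltW eps_gt0)).
Qed.

(** Solving for [w i0] turns the hyperplane into a graph, which is exhausted by its parts in the
    cubes of half-side [K]. *)
Lemma lebesgue_null_hyperplane {R : realType} {I : finType} (c : I -> R)
    (i0 : I) :
  c i0 != 0 -> lebesgue_null [set w : I -> R | \sum_i c i * w i = 0].
Proof.
move=> ci0 eps /(lebesgue_null_bigcup
  (lebesgue_null_bounded_graph i0 (fun i => - c i / c i0))).
move=> [a [b [le_ab cover vol]]]; exists a, b; split => // w /= cw0; apply: cover.
exists (Num.truncn (\sum_i `|w i|)).+1 => //; split => [i|].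
  apply/ltW; rewrite -truncn_lt_nat// ltnS le_truncn//.
  by rewrite (bigD1 i)//= lerDl sumr_ge0.
apply: (mulfI ci0); rewrite mulr_sumr.
move: cw0; rewrite (bigD1 i0)//= => /eqP; rewrite addr_eq0 => /eqP->.
by rewrite -sumrN; apply: eq_bigr => i _; field.
Qed.

(** * Left null vectors of the Laplacian and the leaders of the graph *)

Section LeftKernel.
Context {R : realType} {n : nat} {E : rel 'I_n} {alpha : 'I_n -> 'I_n -> R}.
Hypothesis E_irr : irreflexive E.
Hypothesis alpha_gt0 : forall i j, E i j -> 0 < alpha i j.

Let outdeg j := \sum_(k | E j k) alpha j k.

(** Column [j] reads as a balance of flow: what leaves [j] is what enters it. Irreflexivity keeps
    the diagonal out of the incoming sum. *)
Lemma laplacian_left_kernelP (v : 'rV[R]_n) :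
  v *m laplacian E alpha = 0 <->
  forall j, v 0 j * outdeg j = \sum_(i | E i j) v 0 i * alpha i j.
Proof.
have entry j : (v *m laplacian E alpha) 0 j =
    v 0 j * outdeg j - \sum_(i | E i j) v 0 i * alpha i j.
  rewrite mxE (bigD1 j)//= mxE eqxx; congr (_ + _).
  rewrite -sumrN [RHS]big_mkcond [RHS](bigD1 j)//= E_irr add0r.
  apply: eq_bigr => i /negbTE ij; rewrite mxE ij.
  by case: ifP => _; rewrite ?mulrN ?mulr0.
split=> [/rowP vL j|vL]; first by apply/eqP; rewrite -subr_eq0 -entry vL mxE.
by apply/rowP => j; rewrite entry vL subrr mxE.
Qed.

Lemma sum_outdeg (v : 'I_n -> R) :
  \sum_j \sum_(i | E i j) v i * alpha i j = \sum_i v i * outdeg i.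
Proof.
by rewrite (exchange_big_dep xpredT)//=; apply: eq_bigr => i _; rewrite mulr_sumr.
Qed.

(* Both sides of the triangle inequality in column [j] have the same sum
   over [j], so that it is an equality in each column. *)
Lemma laplacian_left_kernel_norm (v : 'rV[R]_n) :
  v *m laplacian E alpha = 0 ->
  (\row_i `|v 0 i|) *m laplacian E alpha = 0.
Proof.
move=> /laplacian_left_kernelP vL; apply/laplacian_left_kernelP => j.
rewrite mxE; under eq_bigr do rewrite mxE.
have outdeg_ge0 i : 0 <= outdeg i by apply: sumr_ge0 => k /alpha_gt0/ltW.
pose gap k := \sum_(i | E i k) `|v 0 i| * alpha i k - `|v 0 k| * outdeg k.
have gap_ge0 k : 0 <= gap k.
  rewrite subr_ge0 -(ger0_norm (outdeg_ge0 k)) -normrM vL.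
  apply: le_trans (ler_norm_sum _ _ _) _; apply: ler_sum => i /alpha_gt0 a0.
  by rewrite normrM (gtr0_norm a0).
have gap_sum : \sum_k gap k = 0.
  by rewrite sumrB (sum_outdeg (fun i => `|v 0 i|)) subrr.
have /allP/(_ j) : all (fun k => xpredT k ==> (gap k == 0)) (index_enum 'I_n).
  by rewrite -psumr_eq0 ?gap_sum// => k _; exact: gap_ge0.
by rewrite mem_index_enum subr_eq0 => /(_ isT)/eqP.
Qed.

(** The inflow at [j] contains the positive term of the edge [ij]. The product form serves twice: it
    makes [v 0 j] positive, and it is absurd when [j] has no outgoing edge. *)
Lemma nonneg_left_kernel_edge (v : 'rV[R]_n) i j :
  v *m laplacian E alpha = 0 -> (forall k, 0 <= v 0 k) ->
  0 < v 0 i -> E i j -> 0 < v 0 j * outdeg j.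
Proof.
move=> /laplacian_left_kernelP vL v_ge0 vi Eij.
rewrite vL (bigD1 i)//= ltr_wpDr//; last by rewrite mulr_gt0// alpha_gt0.
by apply: sumr_ge0 => k /andP[/alpha_gt0/ltW a0 _]; rewrite mulr_ge0.
Qed.

Lemma nonneg_left_kernel_connect (v : 'rV[R]_n) i j :
  v *m laplacian E alpha = 0 -> (forall k, 0 <= v 0 k) ->
  0 < v 0 i -> connect E i j -> 0 < v 0 j.
Proof.
move=> vL v_ge0 + /connectP[p + ->].
elim: p i => //= k p IH i vi /andP[Eik]; apply: IH.
have := nonneg_left_kernel_edge vL v_ge0 vi Eik.
rewrite [X in _ -> is_true X]lt_neqAle v_ge0 andbT.
by case: eqP => // <-; rewrite mul0r ltxx.
Qed.

(* The positive and the negative part of [xi] are left null vectors; if both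
   were nonzero, both would be positive at a leader. *)
Lemma normalized_left_kernel_ge0 (xi : 'rV[R]_n) :
  connected_graph E -> xi *m laplacian E alpha = 0 ->
  \sum_i xi 0 i = 1 -> forall i, 0 <= xi 0 i.
Proof.
move=> [l leader_l] xiL xi1 i; rewrite leNgt; apply/negP => xi_i.
have [j xi_j] : exists j, 0 < xi 0 j.
  apply/existsP; apply: contraT; rewrite negb_exists => /forallP xi_le0.
  have : \sum_j xi 0 j <= 0 by apply: sumr_le0 => j _; rewrite leNgt xi_le0.
  by rewrite xi1 ler10.
have to_l k : connect E k l.
  by have [->|/leader_l//] := eqVneq k l; exact: connect0.
(* [nxi + xi] and [nxi - xi] are twice the positive and the negative part of [xi]; they cannot both
   be positive at [l]. *)
pose nxi : 'rV[R]_n := \row_k `|xi 0 k|.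
have nxiL : nxi *m laplacian E alpha = 0 by exact: laplacian_left_kernel_norm.
have pos : 0 < (nxi + xi) 0 l.
  apply: nonneg_left_kernel_connect (to_l j).
  - by rewrite mulmxDl nxiL xiL addr0.
  - by move=> k; rewrite !mxE; have := ler_norm (- xi 0 k); rewrite normrN; lra.
  - by rewrite !mxE gtr0_norm// addr_gt0.
have neg : 0 < (nxi - xi) 0 l.
  apply: nonneg_left_kernel_connect (to_l i).
  - by rewrite mulmxBl nxiL xiL subr0.
  - by move=> k; rewrite !mxE; have := ler_norm (xi 0 k); lra.
  - by rewrite !mxE ltr0_norm//; lra.
by move: pos neg; rewrite !mxE; case: ger0P; lra.
Qed.

(** Every node could reach [i] through [l], so the head of such an edge would be a second leader. *)
Lemma unique_leader_sink l i :
  is_leader E l -> (forall l', is_leader E l' -> l = l') -> ~~ E l i.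
Proof.
move=> leader_l uniq_l; apply/negP => Eli.
suff /uniq_l li : is_leader E i by rewrite li E_irr in Eli.
move=> k _; have [->|kl] := eqVneq k l; first exact: connect1.
exact: connect_trans (leader_l k kl) (connect1 Eli).
Qed.

(** If [v 0 i] were nonzero, positivity of [|v|] would travel along a path from [i] to the node
    before [l], and the last edge would make [outdeg l] nonzero, although [l] is a sink. *)
Lemma left_kernel_unique_leader (v : 'rV[R]_n) l i :
  is_leader E l -> (forall l', is_leader E l' -> l = l') ->
  v *m laplacian E alpha = 0 -> i != l -> v 0 i = 0.
Proof.
move=> leader_l uniq_l vL il.
have outdeg_l : outdeg l = 0.
  by rewrite /outdeg big_pred0// => k; apply/negbTE; exact: unique_leader_sink.
apply/eqP; apply: contraT => vi.
have nvL := laplacian_left_kernel_norm vL.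
have nv_ge0 k : 0 <= (\row_i `|v 0 i|) 0 k by rewrite mxE.
have nvi : 0 < (\row_i `|v 0 i|) 0 i by rewrite mxE normr_gt0.
have /connectP[p] := leader_l i il; case/lastP: p => [_ li|p k].
  by rewrite li eqxx in il.
rewrite rcons_path last_rcons => /andP[path_p Ekl] lk; subst k.
have nvk : 0 < (\row_i `|v 0 i|) 0 (last i p).
  by apply: nonneg_left_kernel_connect nvi _ => //; apply/connectP; exists p.
have := nonneg_left_kernel_edge nvL nv_ge0 nvk Ekl.
by rewrite outdeg_l mulr0 ltxx.
Qed.

(** A sink reaches only itself, so any leader would coincide with it and be unique. *)
Lemma out_edge_of_not_unique_leader i :
  connected_graph E -> ~ has_unique_leader E -> exists j, E i j.
Proof.
move=> [l leader_l] nuniq.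
apply/existsP; apply: contraT; rewrite negb_exists => /forallP sink_i.
have leader_i l' : is_leader E l' -> i = l'.
  move=> leader_l'; have [//|/leader_l' /connectP[[|k p]//=]] := eqVneq i l'.
  by rewrite (negbTE (sink_i k)).
by case: nuniq; exists i; split=> //; rewrite (leader_i l).
Qed.

End LeftKernel.

(** * The dynamics weighted by a left null vector *)

Definition noise_coef (R : realType) (n : nat) (E : rel 'I_n)
    (alpha g : 'I_n -> 'I_n -> R) (v : 'rV[R]_n) (e : edge E) : R :=
  v 0 (val e).1 * (alpha (val e).1 (val e).2 * g (val e).1 (val e).2).

Section WeightedDynamics.
Context {R : realType} {n : nat} {E : rel 'I_n}.
Context {alpha g : 'I_n -> 'I_n -> R} {r : 'I_n -> R}.
Context {tau kappa1 kappa2 p : R} {v : 'rV[R]_n}.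
Hypothesis E_irr : irreflexive E.
Hypothesis v_left : v *m laplacian E alpha = 0.

(** The differences [x j - x i] assemble to [- L x], which [v] annihilates; only the noise
    remains. *)
Lemma weighted_offset_sum (w : edge E -> R) (x : 'I_n -> R) :
  \sum_i v 0 i * offset_sum alpha g w x i = \sum_e noise_coef alpha g v e * w e.
Proof.
have consensus : \sum_i v 0 i * \sum_(j | E i j) alpha i j * (x j - x i) = 0.
  under eq_bigr => i _.
    under eq_bigr do rewrite mulrBr.
    rewrite sumrB mulrBr -mulr_suml mulrA.
    over.
  apply/eqP; rewrite sumrB subr_eq0; apply/eqP.
  under eq_bigr do rewrite mulr_sumr.
  rewrite (exchange_big_dep xpredT)//=; apply: eq_bigr => j _.
  rewrite ((laplacian_left_kernelP E_irr v).1 v_left) mulr_suml.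
  by apply: eq_bigr => i _; rewrite mulrA.
under eq_bigr => i _.
  rewrite /offset_sum; under eq_bigr do rewrite mulrDr.
  rewrite big_split mulrDr.
  over.
rewrite big_split/= consensus add0r.
under eq_bigr do rewrite mulr_sumr.
(* The pairs satisfying [E] are reindexed by [edge E], where [insub] succeeds, so the default 0 of
   [edge_value] never occurs. *)
rewrite pair_big_dep/= (reindex_omap val (insub : _ -> option (edge E)))/=.
  apply: eq_big => e; first by rewrite valK eqxx (valP e).
  by move=> _; rewrite /edge_value -surjective_pairing valK /noise_coef !mulrA.
by move=> e Ee; rewrite insubT.
Qed.

Context {w : edge E -> R} {x s y : nat -> 'I_n -> R}.
Hypothesis dyn : mean_dynamics alpha r g tau kappa1 kappa2 p w x s y.

Let noise := \sum_e noise_coef alpha g v e * w e.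
Let S k := \sum_i v 0 i * s k i.
Let Y k := \sum_i v 0 i * y k i.

Lemma weighted_skew_step k : S k.+1 = S k + kappa1 * noise - kappa2 * Y k.
Proof.
rewrite /S /Y /noise -(weighted_offset_sum w (x k)) !mulr_sumr -big_split/=.
rewrite -sumrB; apply: eq_bigr => i _; have [_ -> _] := dyn k i; ring.
Qed.

(** [noise] is the fixed point of the recursion for [Y], and each step multiplies the deviation from
    it by [1 - p]. *)
Lemma weighted_integrator k : Y k = noise + (1 - p) ^+ k * (Y 0%N - noise).
Proof.
elim: k => [|k IH]; first by rewrite expr0; ring.
have -> : Y k.+1 = p * noise + (1 - p) * Y k.
  rewrite /Y /noise -(weighted_offset_sum w (x k)) !mulr_sumr -big_split/=.
  by apply: eq_bigr => i _; have [_ _ ->] := dyn k i; ring.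
by rewrite IH exprS; ring.
Qed.

Hypothesis p_gt0 : 0 < p.
Hypothesis p_lt2 : p < 2.

Lemma weighted_integrator_cvg : Y k @[k --> \oo] --> noise.
Proof.
have p_norm : `|1 - p| < 1.
  by rewrite ltr_norml; apply/andP; split; move: p_gt0 p_lt2; lra.
rewrite (funext weighted_integrator) -[X in _ --> X]addr0.
apply: cvgD; first exact: cvg_cst.
rewrite -[X in _ --> X](mul0r (Y 0%N - noise)).
by apply: cvgMr_tmp; exact: cvg_expr.
Qed.

(* Without noise, [S k - kappa2 / p * Y k] is invariant. *)
Lemma weighted_skew_cvg :
  noise = 0 -> S k @[k --> \oo] --> S 0%N - kappa2 / p * Y 0%N.
Proof.
move=> noise0; set l := (X in _ --> X); have p_neq0 : p != 0 by rewrite gt_eqF.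
have inv k : S k = l + kappa2 / p * Y k.
  elim: k => [|k IH]; first by rewrite /l subrK.
  rewrite weighted_skew_step IH noise0 (weighted_integrator k.+1).
  by rewrite (weighted_integrator k) noise0 exprS; field.
(* The correction tends to [kappa2 / p * noise], which is 0. *)
rewrite (funext inv) -[X in _ --> X]addr0; apply: cvgD; first exact: cvg_cst.
rewrite -[X in _ --> X](mulr0 (kappa2 / p)) -noise0.
by apply: cvgMl_tmp; exact: weighted_integrator_cvg.
Qed.

Lemma weighted_skew_drift :
  (S k.+1 - S k) @[k --> \oo] --> (kappa1 - kappa2) * noise.
Proof.
have -> : (fun k => S k.+1 - S k) = (fun k => kappa1 * noise - kappa2 * Y k).
  by apply/funext => k; rewrite weighted_skew_step; ring.
rewrite mulrBl; apply: cvgB; first exact: cvg_cst.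
by apply: cvgMl_tmp; exact: weighted_integrator_cvg.
Qed.

End WeightedDynamics.

Theorem theorem3 (R : realType) (n : nat) (E : rel 'I_n)
    (alpha g : 'I_n -> 'I_n -> R) (r : 'I_n -> R)
    (tau kappa1 kappa2 p : R)
    (J2 : 'M[R[i]]_(3 * n - 3)) (xi : 'rV[R]_n)
    (n_ge2 : (2 <= n)%N)
    (E_irr : irreflexive E)
    (alpha_gt0 : forall i j, E i j -> 0 < alpha i j)
    (g_gt0 : forall i j, E i j -> 0 < g i j)
    (r_gt0 : forall i, 0 < r i)
    (tau_gt0 : 0 < tau)
    (G_conn : connected_graph E)
    (kappa_neq : kappa1 <> kappa2)
    (p_gt0 : 0 < p) (p_lt2 : p < 2)
    (J2_jordan :
       jordan_form_split (sync_mx E alpha r tau kappa1 kappa2 p) p J2)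
    (J2_rho : spectral_radius J2 < 1)
    (xi_left : xi *m laplacian E alpha = 0)
    (xi_sum : \sum_i xi 0 i = 1) :
  (~ has_unique_leader E ->
     exists N : set (edge E -> R), lebesgue_null N /\
       forall w : edge E -> R, ~ N w ->
       forall x s y : nat -> 'I_n -> R,
         mean_dynamics alpha r g tau kappa1 kappa2 p w x s y ->
         exists c : R, c <> 0 /\
           (collective_freq xi r (s k.+1) - collective_freq xi r (s k))
             @[k --> \oo] --> c)
  /\
  (has_unique_leader E ->
     forall w : edge E -> R,
     forall x s y : nat -> 'I_n -> R,
       mean_dynamics alpha r g tau kappa1 kappa2 p w x s y ->
       collective_freq xi r (s k) @[k --> \oo] -->
         gamma_of xi r *
           \sum_i xi 0 i * (s 0%N i - kappa2 / p * y 0%N i)).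
Proof.
have [i xi_i] : exists i, xi 0 i != 0.
  apply/existsP; apply: contraT; rewrite negb_exists => /forallP xi0.
  have : \sum_i xi 0 i = 0 by apply: big1 => i _; apply/eqP/negPn/xi0.
  by rewrite xi_sum => /eqP; rewrite oner_eq0.
split=> [nuniq|[l [leader_l uniq_l]] w x s y dyn].
(* This edge leaves a node where [xi] does not vanish, so its noise coefficient is nonzero. *)
- have [j Eij] := out_edge_of_not_unique_leader i G_conn nuniq.
  have xi_ge0 :=
    normalized_left_kernel_ge0 E_irr alpha_gt0 G_conn xi_left xi_sum.
  (* The inverse of [gamma] is a sum of nonnegative terms with a positive one at [i]. *)
  have gamma_neq0 : gamma_of xi r != 0.
    rewrite invr_neq0// gt_eqF// (bigD1 i)//= ltr_wpDr//.
      by apply: sumr_ge0 => k _; rewrite divr_ge0// ltW.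
    by rewrite divr_gt0// lt_neqAle eq_sym xi_i xi_ge0.
  exists [set w | \sum_e noise_coef alpha g xi e * w e = 0]; split.
    apply: (lebesgue_null_hyperplane (i0 := exist _ (i, j) Eij)).
    by rewrite /noise_coef !mulf_neq0// gt_eqF// (alpha_gt0, g_gt0).
  move=> w /= noise_neq0 x s y dyn.
  exists (gamma_of xi r *
    ((kappa1 - kappa2) * \sum_e noise_coef alpha g xi e * w e)); split.
    by apply/eqP; rewrite !mulf_neq0// ?subr_eq0; apply/eqP.
  under eq_fun do rewrite /collective_freq -mulrBr.
  by apply: cvgMl_tmp; exact: (weighted_skew_drift E_irr xi_left dyn).
- apply: cvgMl_tmp.
  under [X in _ --> X]eq_bigr do rewrite mulrBr mulrCA.
  rewrite sumrB -mulr_sumr.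
  apply: (weighted_skew_cvg E_irr xi_left dyn) => //.
  (* No edge leaves the sink [l], and [xi] vanishes at every other node, so each noise coefficient
     is 0. *)
  apply: big1 => e _.
  have el : (val e).1 != l.
    by apply: contraL (valP e) => /eqP->; exact: unique_leader_sink.
  rewrite /noise_coef.
  rewrite (left_kernel_unique_leader E_irr alpha_gt0 leader_l uniq_l xi_left el).
  by rewrite !mul0r.
Qed.
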